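(* For $\beta>-1$ and integers $m\ge n\ge0$, writing $w_{m,n}$ for $w^{(\beta)}_{m,n}(z_1,z_2|q)$, $$\frac{z_2\,w_{m+1,n}}{q^n(1-q^{m-n+\beta+1})}=w_{m,n}-w_{m+1,n+1},$$ $$z_1(1-q^{m-n+\beta+1})w_{m,n}=(1-q^{m+\beta+1})w_{m+1,n}-q^{m-n+\beta+1}(1-q^n)w_{m,n-1},$$ $$\big(q^n+q^{m+\beta}(1-q^n-q^{n+1})-z_1z_2\big)w_{m,n}=q^n(1-q^{m+\beta+1})w_{m+1,n+1}+q^{m+\beta}(1-q^n)w_{m-1,n-1}.$$
   Context: $0<q<1$; $(a;q)_n=\prod_{k=0}^{n-1}(1-aq^k)$, $(a,b;q)_n=(a;q)_n(b;q)_n$. The little $q$-Laguerre (Wall) polynomials are $$p_n(x;q^\alpha|q)=\sum_{k=0}^n\frac{(q;q)_n\,q^{(k-n)(n+k-1)/2}(-x)^{n-k}}{(q;q)_k(q,q^{\alpha+1};q)_{n-k}}.$$ For $\beta>-1$, $w^{(\beta)}_{m,n}(z_1,z_2|q)=z_1^{m-n}p_n(z_1z_2;q^{\beta+m-n}|q)$ if $m\ge n$, and $w^{(\beta)}_{m,n}(z_1,z_2|q)=w^{(\beta)}_{n,m}(z_2,z_1|q)$ if $m<n$; terms with a negative index are $0$. *)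

(* Defs.v *)
From HB Require Import structures.
From mathcomp Require Import all_boot all_order all_algebra.
From mathcomp Require Import complex.
From mathcomp Require Import reals exp.

Set Implicit Arguments.
Unset Strict Implicit.
Unset Printing Implicit Defensive.

Import Order.TTheory GRing.Theory Num.Theory.
Local Open Scope ring_scope.
Local Open Scope complex_scope.

Definition qpoch (R : realType) (a q : R) (n : nat) : R :=
  \prod_(k < n) (1 - a * q ^+ k).

Definition qpoch2 (R : realType) (a b q : R) (n : nat) : R :=
  qpoch a q n * qpoch b q n.

(* [little_q_laguerre q alpha n x] is p_n(x; q^alpha | q): the second argument
   is the exponent alpha, not the value q^alpha. *)
Definition little_q_laguerre (R : realType) (q alpha : R) (n : nat)
    (x : R[i]) : R[i] :=
  \sum_(k < n.+1)
    (qpoch q q n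
     * q `^ ((k%:R - n%:R) * (n%:R + k%:R - 1) / 2%:R)
     / (qpoch q q k * qpoch2 q (q `^ (alpha + 1)) q (n - k)))%:C
    * (- x) ^+ (n - k).

(* The formula for m >= n; the truncated subtraction [m - n] is only
   meaningful in that range. *)
Definition w_ge (R : realType) (q beta : R) (m n : nat) (z1 z2 : R[i]) : R[i] :=
  z1 ^+ (m - n) * little_q_laguerre q (beta + (m - n)%:R) n (z1 * z2).

(* Integer indices, so that the convention "zero when an index is negative"
   is part of the definition. *)
Definition w (R : realType) (q beta : R) (m n : int) (z1 z2 : R[i]) : R[i] :=
  match m, n with
  | Posz m', Posz n' =>
      if (n' <= m')%N then w_ge q beta m' n' z1 z2 else w_ge q beta n' m' z2 z1
  | _, _ => 0
  end.

(* Main.v *)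
Require Import Defs.
From mathcomp Require Import all_boot all_order all_algebra.
From mathcomp Require Import complex.
From mathcomp Require Import reals exp.
From mathcomp Require Import ring lra.

Import Order.TTheory GRing.Theory Num.Theory.
Local Open Scope ring_scope.
Local Open Scope complex_scope.

(** With [d = m - n], [A = q^(beta + d + 1)] and [x = z1 z2], each function
    occurring in the theorem is a power of [z1] times a little q-Laguerre
    polynomial [wall q A n x]; raising [m] alone replaces [A] by [A q], while
    raising both indices keeps [A] and raises [n].  The first two identities
    are then the contiguous relations
      [x p_n(A q) = q^n (1 - A) (p_n(A) - p_(n+1)(A))]  ([wall_raise]),
      [(1 - A) p_n(A) = (1 - A q^n) p_n(A q) - A (1 - q^n) p_(n-1)(A q)]
    ([wall_shift]), and the third, the three-term recurrence [wall_rec],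
    follows by multiplying the second by [x], rewriting both terms on its
    right-hand side by the first, and cancelling [1 - A].  Since [beta > -1]
    and [q < 1] give [A < 1], no denominator vanishes.

    The contiguous relations hold coefficient by coefficient.  This is easiest
    to see on the hypergeometric form
      [p_n(x) = sum_j (q^-n; q)_j (q x)^j / ((q; q)_j (A; q)_j)],
    whose coefficients vanish by themselves for [j > n], so that polynomials
    of different degrees can be summed over a common range.  Each relation
    then reduces to the two ways of splitting one factor off a shifted
    factorial, [qpochS] and [qpochS_shift].  Reversing the factors of
    [(q^-n; q)_j] turns the defining sum into this form ([qpoch_reverse],
    [little_q_laguerreE]). *)

(** * Shifted factorials *)

Section ShiftedFactorial.

Set Implicit Arguments.
Unset Strict Implicit.

Variable R : realType.
Implicit Types (a q : R) (n j : nat).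

Lemma qpochS a q n : qpoch a q n.+1 = qpoch a q n * (1 - a * q ^+ n).
Proof. by rewrite /qpoch big_ord_recr. Qed.

Lemma qpochS_shift a q n : qpoch a q n.+1 = (1 - a) * qpoch (a * q) q n.
Proof.
rewrite /qpoch big_ord_recl expr0 mulr1; congr (_ * _).
by apply: eq_bigr => i _; rewrite lift0 exprS mulrA.
Qed.

Lemma qpoch_neq0 a q n : 0 < q -> q < 1 -> a < 1 -> qpoch a q n != 0.
Proof.
move=> q0 q1 a1; apply/prodf_neq0 => k _; rewrite subr_eq0 eq_sym.
have qk1 : q ^+ k <= 1 by rewrite exprn_ile1 // ltW.
have qk0 : 0 < q ^+ k by rewrite exprn_gt0.
rewrite lt_eqF //; apply: lt_le_trans qk1.
by rewrite gtr_pMl.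
Qed.

End ShiftedFactorial.

(** * Contiguous relations of the little q-Laguerre polynomials *)

Section Wall.

Set Implicit Arguments.
Unset Strict Implicit.

Variable R : realType.
Implicit Types (q A : R) (n j : nat) (x : R[i]).

Definition wall_coef q A n j : R :=
  qpoch (q ^+ n)^-1 q j * q ^+ j / (qpoch q q j * qpoch A q j).

(** The parameter is [A = q^(alpha + 1)], so that increasing [alpha] by one is
    multiplication of [A] by [q]. *)
Definition wall q A n x : R[i] :=
  \sum_(j < n.+1) (wall_coef q A n j)%:C * x ^+ j.

Lemma wall_coef0 q A n : wall_coef q A n 0 = 1.
Proof. by rewrite /wall_coef /qpoch !big_ord0 expr0 !mulr1 divr1. Qed.

(** The factor of index [n] of [(q^-n; q)_j] is zero. *)
Lemma wall_coef_eq0 q A n j : q != 0 -> (n < j)%N -> wall_coef q A n j = 0.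
Proof.
move=> q0 ltnj; rewrite /wall_coef /qpoch (bigD1 (Ordinal ltnj)) //=.
by rewrite mulVf ?expf_neq0 // subrr !mul0r.
Qed.

(** Brings polynomials of different degrees to a common range of summation. *)
Lemma wall_widen q A n N x : q != 0 -> (n < N)%N ->
  wall q A n x = \sum_(j < N) (wall_coef q A n j)%:C * x ^+ j.
Proof.
move=> q0 ltnN.
rewrite /wall (big_ord_widen N (fun j => (wall_coef q A n j)%:C * x ^+ j)) //.
rewrite big_mkcond; apply: eq_bigr => j _; case: ifP => // /negbT.
by rewrite -leqNgt => ltnj; rewrite wall_coef_eq0 // rmorph0 mul0r.
Qed.

(** Since [(A; q)_(j+1) = (1 - A) (A q; q)_j] and
    [(q^-(n+1); q)_(j+1) = (1 - q^-(n+1)) (q^-n; q)_j], every term is a multiple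
    of the left-hand side, and what remains is
    [(1 - q^(j-n)) - (1 - q^-(n+1)) = q^-(n+1) (1 - q^(j+1))]. *)
Lemma wall_coef_raise q A n j : 0 < q -> q < 1 -> A < 1 ->
  wall_coef q (A * q) n j
  = q ^+ n * (1 - A) * (wall_coef q A n j.+1 - wall_coef q A n.+1 j.+1).
Proof.
move=> q0 q1 A1; have qN0 : q != 0 by rewrite gt_eqF.
have A1' : 1 - A != 0 by rewrite subr_eq0 gt_eqF.
have Aq1 : A * q < 1 by rewrite (lt_trans _ q1) // gtr_pMl.
have := qpoch_neq0 j.+1 q0 q1 q1; have := qpoch_neq0 j q0 q1 Aq1.
have shiftV : (q ^+ n.+1)^-1 * q = (q ^+ n)^-1.
  by rewrite exprSr invfM -mulrA mulVf // mulr1.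
rewrite /wall_coef (qpochS_shift A) (qpochS_shift (q ^+ n.+1)^-1) shiftV.
rewrite (qpochS q) (qpochS (q ^+ n)^-1) !exprS mulf_eq0 negb_or.
move=> D1 /andP[D2 D3].
have qn0 : q ^+ n != 0 by rewrite expf_neq0.
by field; rewrite ?qN0 ?A1' ?D1 ?D2 ?D3 ?qn0.
Qed.

(** Splitting off the first or the last factor of [(q^-n; q)_(j+1)] shows that
    both sides are [- q^n (q^-n; q)_(j+1)]; for [n = 0] this is zero, so the
    truncated [n.-1] does no harm. *)
Lemma qpoch_negpow_pred q n j : q != 0 ->
  (1 - q ^+ n) * qpoch (q ^+ n.-1)^-1 q j
  = qpoch (q ^+ n)^-1 q j * (q ^+ j - q ^+ n).
Proof.
move=> q0; have qn0 : q ^+ n != 0 by rewrite expf_neq0.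
have -> : q ^+ j - q ^+ n = - q ^+ n * (1 - (q ^+ n)^-1 * q ^+ j) by field.
rewrite mulrCA -qpochS qpochS_shift.
case: n qn0 => [|n] qn0 /=; first by rewrite expr0 invr1 subrr !mul0r mulr0.
have -> : (q ^+ n.+1)^-1 * q = (q ^+ n)^-1.
  by rewrite exprSr invfM -mulrA mulVf // mulr1.
by field.
Qed.

(** Over the common denominator [(q; q)_j (A q; q)_j] the relation becomes
    [1 - A q^j = (1 - A q^n) - A (q^j - q^n)]. *)
Lemma wall_coef_shift q A n j : 0 < q -> q < 1 -> A < 1 ->
  (1 - A) * wall_coef q A n j
  = (1 - A * q ^+ n) * wall_coef q (A * q) n j
    - A * (1 - q ^+ n) * wall_coef q (A * q) n.-1 j.
Proof.
move=> q0 q1 A1; have qN0 : q != 0 by rewrite gt_eqF.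
have Aq1 : A * q < 1 by rewrite (lt_trans _ q1) // gtr_pMl.
have DA := qpoch_neq0 j q0 q1 A1; have DAq := qpoch_neq0 j q0 q1 Aq1.
have Dq := qpoch_neq0 j q0 q1 q1.
have splitA : (1 - A) / qpoch A q j = (1 - A * q ^+ j) / qpoch (A * q) q j.
  by apply/eqP; rewrite eqr_div // -qpochS_shift qpochS mulrC.
rewrite /wall_coef.
have -> : (1 - A)
    * (qpoch (q ^+ n)^-1 q j * q ^+ j / (qpoch q q j * qpoch A q j))
  = (1 - A) / qpoch A q j * (qpoch (q ^+ n)^-1 q j * q ^+ j / qpoch q q j).
  by field; rewrite DA Dq.
have -> : A * (1 - q ^+ n)
    * (qpoch (q ^+ n.-1)^-1 q j * q ^+ j / (qpoch q q j * qpoch (A * q) q j))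
  = A * ((1 - q ^+ n) * qpoch (q ^+ n.-1)^-1 q j) * q ^+ j
    / (qpoch q q j * qpoch (A * q) q j).
  by field; rewrite DAq Dq.
by rewrite splitA qpoch_negpow_pred //; field; rewrite DAq Dq.
Qed.

(** The constant terms of [p_n] and [p_(n+1)] are both [1]; once they cancel,
    the difference is divisible by [x]. *)
Lemma wall_raise q A n x : 0 < q -> q < 1 -> A < 1 ->
  x * wall q (A * q) n x
  = (q ^+ n * (1 - A))%:C * (wall q A n x - wall q A n.+1 x).
Proof.
move=> q0 q1 A1; have qN0 : q != 0 by rewrite gt_eqF.
rewrite (@wall_widen q A n n.+2) // (@wall_widen q A n.+1 n.+2) //.
rewrite -sumrB big_ord_recl !wall_coef0 subrr add0r.
rewrite /wall !mulr_sumr; apply: eq_bigr => j _.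
by rewrite !lift0 wall_coef_raise // rmorphM rmorphB exprS; ring.
Qed.

Lemma wall_shift q A n x : 0 < q -> q < 1 -> A < 1 ->
  (1 - A)%:C * wall q A n x
  = (1 - A * q ^+ n)%:C * wall q (A * q) n x
    - (A * (1 - q ^+ n))%:C * wall q (A * q) n.-1 x.
Proof.
move=> q0 q1 A1; have qN0 : q != 0 by rewrite gt_eqF.
rewrite (@wall_widen q (A * q) n.-1 n.+1) // ?ltnS ?leq_pred //.
rewrite /wall !mulr_sumr -sumrB; apply: eq_bigr => j _.
by rewrite !mulrA -!rmorphM -mulrBl -rmorphB -wall_coef_shift.
Qed.

Lemma wall_rec q A n x : 0 < q -> q < 1 -> A < 1 ->
  x * wall q A n x
  = (q ^+ n * (1 - A * q ^+ n))%:C * (wall q A n x - wall q A n.+1 x)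
    - (A * (1 - q ^+ n) * q ^+ n.-1)%:C * (wall q A n.-1 x - wall q A n x).
Proof.
move=> q0 q1 A1.
have A1' : (1 - A)%:C != 0 :> R[i].
  by rewrite fmorph_eq0 subr_eq0 gt_eqF.
apply: (mulfI A1'); rewrite mulrCA wall_shift // mulrBr !(mulrCA x).
rewrite wall_raise //.
case: n => [|n] /=; last by rewrite wall_raise // !rmorphM; ring.
by rewrite expr0 subrr mulr0 mul0r !rmorph0 !mul0r !subr0 !rmorphM; ring.
Qed.

End Wall.

(** * Identification with the definitions *)

Section Identification.

Set Implicit Arguments.
Unset Strict Implicit.

Variable R : realType.
Implicit Types (q alpha beta : R) (n d j : nat) (x : R[i]).

Lemma powR_addn q alpha n : 0 < q -> q `^ (alpha + n%:R) = q `^ alpha * q ^+ n.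
Proof.
move=> q0; rewrite powRD ?powR_mulrn ?(ltW q0) //.
by rewrite [q == 0]gt_eqF // implybT.
Qed.

Lemma powR_lt1 q alpha : 0 < q -> q < 1 -> 0 < alpha -> q `^ alpha < 1.
Proof.
move=> q0 q1 a0; have <- : 1 `^ alpha = 1 :> R by rewrite powR1.
by apply: gt0_ltr_powR => //; rewrite nnegrE ltW.
Qed.

(** Reversing the factors of [(q^-n; q)_j] gives
    [(q^-n; q)_j = (-1)^j q^(j (j - 1) / 2 - n j) (q; q)_n / (q; q)_(n - j)];
    the exponent on the left-hand side below contains one more [j]. *)
Lemma qpoch_reverse q n j : 0 < q -> (j <= n)%N ->
  qpoch q q n * q `^ (j%:R * (j%:R + 1 - 2 * n%:R) / 2) * (-1) ^+ j
  = qpoch q q (n - j) * qpoch (q ^+ n)^-1 q j * q ^+ j.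
Proof.
move=> q0; have qN0 : q != 0 by rewrite gt_eqF.
elim: j => [|j IH] ltjn.
  by rewrite subn0 !mul0r powRr0 /qpoch [X in _ = _ * X * _]big_ord0 !mulr1.
have -> : j.+1%:R * (j.+1%:R + 1 - 2 * n%:R) / 2
    = j%:R * (j%:R + 1 - 2 * n%:R) / 2 + 1 + j%:R - n%:R :> R.
  by rewrite -natr1; field.
rewrite powRD ?qN0 ?implybT // powRN powR_mulrn ?(ltW q0) //.
rewrite powR_addn // powRD ?qN0 ?implybT // powRr1 ?(ltW q0) //.
transitivity (qpoch q q n * q `^ (j%:R * (j%:R + 1 - 2 * n%:R) / 2) * (-1) ^+ j
   * - (q * q ^+ j / q ^+ n)); first by rewrite exprS; ring.
rewrite (IH (ltnW ltjn)) (qpochS (q ^+ n)^-1) -(subnSK ltjn) qpochS.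
have -> : q ^+ n = q ^+ (n - j.+1) * q * q ^+ j.
  by rewrite -exprSr -exprD subnSK // subnK // ltnW.
by rewrite !exprS; field; rewrite qN0 !expf_neq0.
Qed.

Lemma little_q_laguerreE q alpha n x : 0 < q -> q < 1 -> -1 < alpha ->
  little_q_laguerre q alpha n x = wall q (q `^ (alpha + 1)) n x.
Proof.
move=> q0 q1 a1.
have A1 : q `^ (alpha + 1) < 1 by apply: powR_lt1 => //; lra.
rewrite /little_q_laguerre /wall (reindex_inj rev_ord_inj) /=.
apply: eq_bigr => -[j /=]; rewrite ltnS => lejn _.
rewrite subSS subKn // exprNn.
rewrite -[(-1) ^+ j](rmorph_sign (real_complex R)) mulrA -rmorphM.
congr (_%:C * _); rewrite /wall_coef /qpoch2.
have -> : ((n - j)%:R - n%:R) * (n%:R + (n - j)%:R - 1) / 2%:R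
    = j%:R * (j%:R + 1 - 2 * n%:R) / 2 :> R by rewrite natrB //; field.
have Dnj := qpoch_neq0 (n - j) q0 q1 q1; have Dj := qpoch_neq0 j q0 q1 q1.
have DA := qpoch_neq0 j q0 q1 A1.
rewrite mulrAC qpoch_reverse //.
by field; rewrite Dnj Dj DA.
Qed.

Lemma wE q beta n d z1 z2 : 0 < q -> q < 1 -> -1 < beta ->
  w q beta (n + d)%N%:Z n%:Z z1 z2
  = z1 ^+ d * wall q (q `^ (beta + 1) * q ^+ d) n (z1 * z2).
Proof.
move=> q0 q1 b1; rewrite /w /w_ge leq_addr addKn.
have d0 : 0 <= d%:R :> R by exact: ler0n.
have bd : -1 < beta + d%:R by lra.
by rewrite little_q_laguerreE // addrAC powR_addn.
Qed.

End Identification.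

Theorem theorem5p8 (R : realType) (q beta : R) (hq0 : 0 < q) (hq1 : q < 1)
    (hbeta : -1 < beta) (m n : nat) (hnm : (n <= m)%N) (z1 z2 : R[i]) :
  let W := fun i j : int => w q beta i j z1 z2 in
  [/\ z2 * W (m%:Z + 1) n%:Z
        / (q ^+ n * (1 - q `^ (m%:R - n%:R + beta + 1)))%:C
      = W m%:Z n%:Z - W (m%:Z + 1) (n%:Z + 1),
      z1 * (1 - q `^ (m%:R - n%:R + beta + 1))%:C * W m%:Z n%:Z
      = (1 - q `^ (m%:R + beta + 1))%:C * W (m%:Z + 1) n%:Z
        - (q `^ (m%:R - n%:R + beta + 1) * (1 - q ^+ n))%:C
          * W m%:Z (n%:Z - 1)
    & ((q ^+ n + q `^ (m%:R + beta) * (1 - q ^+ n - q ^+ n.+1))%:C - z1 * z2)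
        * W m%:Z n%:Z
      = (q ^+ n * (1 - q `^ (m%:R + beta + 1)))%:C * W (m%:Z + 1) (n%:Z + 1)
        + (q `^ (m%:R + beta) * (1 - q ^+ n))%:C * W (m%:Z - 1) (n%:Z - 1)].
Proof.
move=> W.
have [d ->] : exists d, m = (n + d)%N by exists (m - n)%N; rewrite subnKC.
have qN0 : q != 0 by rewrite gt_eqF.
have d0 : 0 <= d%:R :> R by exact: ler0n.
pose A := q `^ (beta + 1) * q ^+ d.
have EA : q `^ ((n + d)%N%:R - n%:R + beta + 1) = A.
  by rewrite /A -powR_addn //; congr (_ `^ _); rewrite natrD; ring.
have EAn : q `^ ((n + d)%N%:R + beta + 1) = A * q ^+ n.
  by rewrite /A -!powR_addn //; congr (_ `^ _); rewrite natrD; ring.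
have EAn' : q `^ ((n + d)%N%:R + beta) * q = A * q ^+ n.
  by rewrite -[in X in _ * X = _](powRr1 (ltW hq0)) -powRD ?qN0 ?implybT.
have A1 : A < 1 by rewrite -EA powR_lt1 // natrD; lra.
pose p k := wall q A k (z1 * z2).
pose p' k := wall q (A * q) k (z1 * z2).
have Wmn : W (n + d)%N%:Z n%:Z = z1 ^+ d * p n by rewrite /W wE.
have Wm1n1 : W ((n + d)%N%:Z + 1) (n%:Z + 1) = z1 ^+ d * p n.+1.
  by rewrite /W -!PoszD !addn1 -addSn wE.
have Wm1n : W ((n + d)%N%:Z + 1) n%:Z = z1 ^+ d.+1 * p' n.
  by rewrite /W -PoszD addn1 -addnS wE // /p' /A -[in RHS]mulrA -exprSr.
(* Lowering [n] is stated with a factor that vanishes at [n = 0], where the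
   polynomial side uses [n.-1 = 0] and the other side the zero convention. *)
have Wmn1 : (1 - q ^+ n)%:C * W (n + d)%N%:Z (n%:Z - 1)
    = (1 - q ^+ n)%:C * (z1 ^+ d.+1 * p' n.-1).
  rewrite /W; case: (n) => [|k]; first by rewrite expr0 subrr !mul0r.
  by rewrite -predn_int // addSnnS wE // /p' /A -[in RHS]mulrA -exprSr.
have Wm1n1' : (1 - q ^+ n)%:C * W ((n + d)%N%:Z - 1) (n%:Z - 1)
    = (1 - q ^+ n)%:C * (z1 ^+ d * p n.-1).
  rewrite /W; case: (n) => [|k]; first by rewrite expr0 subrr !mul0r.
  by rewrite -!predn_int // addSn wE.
rewrite EA EAn Wmn Wm1n1 Wm1n; split.
- have D0 : (q ^+ n * (1 - A))%:C != 0 :> R[i].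
    by rewrite fmorph_eq0 mulf_neq0 ?expf_neq0 // subr_eq0 gt_eqF.
  apply: (mulIf D0); rewrite divfK //.
  have := wall_raise n (z1 * z2) hq0 hq1 A1.
  rewrite -/(p' n) -/(p n) -/(p n.+1) => E.
  transitivity (z1 ^+ d * (z1 * z2 * p' n)); first by rewrite exprS; ring.
  by rewrite E; ring.
- have := wall_shift n (z1 * z2) hq0 hq1 A1.
  rewrite -/(p' n) -/(p n) -/(p' n.-1) [(A * _)%:C]rmorphM => E.
  rewrite -(mulrA A%:C) Wmn1.
  transitivity (z1 ^+ d.+1 * ((1 - A)%:C * p n)); first by rewrite exprS; ring.
  by rewrite E; ring.
- have := wall_rec n (z1 * z2) hq0 hq1 A1.
  rewrite -/(p n) -/(p n.+1) -/(p n.-1) => E.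
  rewrite [(_ * (1 - q ^+ n))%:C]rmorphM -[X in _ = _ + X]mulrA Wm1n1'.
  rewrite mulrBl [X in _ - X]mulrCA E.
  have EC : (q `^ ((n + d)%N%:R + beta) * (1 - q ^+ n))%:C
     = (A * (1 - q ^+ n) * q ^+ n.-1)%:C :> R[i].
    congr (_%:C); case: (n) EAn' => [|k] EAn''.
      by rewrite subrr !(mulr0, mul0r).
    by apply: (mulIf qN0); rewrite mulrAC EAn'' exprSr /=; ring.
  have EC2 : q ^+ n + q `^ ((n + d)%N%:R + beta) * (1 - q ^+ n - q ^+ n.+1)
    = q ^+ n * (1 - A * q ^+ n) + q `^ ((n + d)%N%:R + beta) * (1 - q ^+ n).
    by rewrite -EAn' exprS; ring.
  by rewrite -EC EC2 rmorphD [(_ * (1 - q ^+ n))%:C]rmorphM; ring.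
Qed.
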